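(* Let $\ell\le \frac16\log\log n$, $\alpha=2^{\ell+1}-1$, $m=\binom n2$, and let $\mathcal C=\{C_m\}$ be a family of circuits computing $\mathrm{CLIQUE}(n,n^{1/(6\alpha)})$ with $\ell+k$ negation gates. Suppose that at least $k$ of the negation gates compute functions that are sensitive only on $w$ inputs, i.e. the weight of the orientation of the function computed at the input of the negation gate plus the weight of the orientation of the function computed at its output is at most $w$, with $kw\le n/8$, while the remaining $\ell$ negation gates compute functions of arbitrary orientation. Then $\mathrm{Depth}(C_m)\ge n^{1/2^{\ell+8}}$.
   Context: Circuits have $\land,\lor$ gates of fan-in at most two and $\neg$ gates. A Boolean function $f:\{0,1\}^N\to\{0,1\}$ has orientation $\beta\in\{0,1\}^N$ if there is a monotone $h$ with $f(x)=h(x,x\oplus\beta)$ for all $x$; its weight is the number of ones of $\beta$ (here the minimal orientation is meant). $\mathrm{CLIQUE}(n,s)$ is the function on $\binom n2$ edge variables of an $n$-vertex graph that is $1$ iff the graph contains a clique of size $s$.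
   Formalization: The bound is proved for all n above one absolute threshold (uniform in ℓ, k, w and the circuit), since it fails for small n such as n = 2; the clique size n^{1/(6α)}, not always an integer, is rounded either up or down. *)

(* Defs.v *)
From mathcomp Require Export all_boot all_order all_algebra.
From mathcomp Require Export all_classical all_reals all_analysis.

Set Implicit Arguments.
Unset Strict Implicit.
Unset Printing Implicit Defensive.

Import Order.TTheory GRing.Theory Num.Theory.

Local Open Scope nat_scope.

(* [{0,1}^N] is rendered as [{ffun I -> bool}], with [I] a finite type of [N]
   variables. *)

Definition monotone (J : finType) (h : {ffun J -> bool} -> bool) : Prop :=
  forall x y : {ffun J -> bool}, (forall j, x j ==> y j) -> h x ==> h y.

(* The point (x, x \oplus beta) of {0,1}^(2N). *)
Definition oriented_input (I : finType) (beta x : {ffun I -> bool}) :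
    {ffun I + I -> bool} :=
  [ffun j => match j with inl i => x i | inr i => x i (+) beta i end].

Definition has_orientation (I : finType) (f : {ffun I -> bool} -> bool)
    (beta : {ffun I -> bool}) : Prop :=
  exists2 h : {ffun I + I -> bool} -> bool,
    monotone h & forall x, f x = h (oriented_input beta x).

Definition weight (I : finType) (beta : {ffun I -> bool}) : nat :=
  #|[set i | beta i]|.

(* The default value 1^N of the arg min is always an orientation, see
   [has_orientation_full]. *)
Definition min_orientation (I : finType) (f : {ffun I -> bool} -> bool) :
    {ffun I -> bool} :=
  [arg min_(beta < [ffun=> true] | `[< has_orientation f beta >]) weight beta]%N.

Definition orientation_weight (I : finType) (f : {ffun I -> bool} -> bool) : nat :=
  weight (min_orientation f).

Lemma has_orientation_full (I : finType) (f : {ffun I -> bool} -> bool) :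
  has_orientation f [ffun=> true].
Proof.
exists (fun z => [exists a : {ffun I -> bool}, f a &&
   [forall j, oriented_input [ffun=> true] a j ==> z j]]).
  move=> y z yz; apply/implyP => /existsP[a /andP[fa /forallP ay]].
  apply/existsP; exists a; rewrite fa /=; apply/forallP => j.
  by apply/implyP => /(implyP (ay j)); apply/implyP.
move=> x; apply/idP/existsP => [fx|[a /andP[fa /forallP ax]]].
  by exists x; rewrite fx /=; apply/forallP => j; apply: implybb.
suff -> : x = a by [].
apply/ffunP => i; move: (ax (inl i)) (ax (inr i)); rewrite !ffunE /=.
by case: (a i); case: (x i).
Qed.

Lemma min_orientationP (I : finType) (f : {ffun I -> bool} -> bool) :
  has_orientation f (min_orientation f) /\
  forall beta, has_orientation f beta -> orientation_weight f <= weight beta.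
Proof.
rewrite /orientation_weight /min_orientation.
case: arg_minnP => [|b /asboolP fb bmin].
  exact/asboolP/has_orientation_full.
by split => // c fc; apply/bmin/asboolP.
Qed.

(* A circuit is a list of gates in topological order, in which a gate names its
   predecessors by their positions; fan-out is unbounded, and AND / OR gates of
   fan-in 0 are the constants. *)

Variant gate (I : Type) : Type :=
| InputGate of I
| NotGate of nat
| AndGate of seq nat
| OrGate of seq nat.

Definition preds (I : Type) (g : gate I) : seq nat :=
  match g with
  | InputGate _ => [::]
  | NotGate j => [:: j]
  | AndGate js | OrGate js => js
  end.

Record circuit (I : Type) : Type := Circuit {
  gates : seq (gate I);
  output : nat;
  output_lt : output < size gates;
  preds_lt : forall i g, onth gates i = Some g -> all (fun j => j < i) (preds g);
  fan_in_le2 : forall i g, onth gates i = Some g -> size (preds g) <= 2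
}.

Definition gate_value (I : Type) (x : I -> bool) (vs : seq bool) (g : gate I) : bool :=
  match g with
  | InputGate i => x i
  | NotGate j => ~~ nth false vs j
  | AndGate js => all (nth false vs) js
  | OrGate js => has (nth false vs) js
  end.

Definition gate_values (I : Type) (gs : seq (gate I)) (x : I -> bool) : seq bool :=
  foldl (fun vs g => rcons vs (gate_value x vs g)) [::] gs.

Definition gate_fun (I : finType) (C : circuit I) (i : nat)
    (x : {ffun I -> bool}) : bool :=
  nth false (gate_values (gates C) x) i.

Definition computes (I : finType) (C : circuit I)
    (f : {ffun I -> bool} -> bool) : Prop :=
  forall x, gate_fun C (output C) x = f x.

(* Number of edges on a longest path ending at a gate; negation gates count. *)
Definition gate_depths (I : Type) (gs : seq (gate I)) : seq nat :=
  foldl (fun ds g => rcons ds (\max_(j <- preds g) (nth 0 ds j).+1)) [::] gs.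

Definition depth (I : Type) (C : circuit I) : nat :=
  nth 0 (gate_depths (gates C)) (output C).

Definition negations (I : Type) (C : circuit I) : nat :=
  count (fun g => if g is NotGate _ then true else false) (gates C).

(* Number of negation gates whose input and output functions have minimal
   orientations of total weight at most [w]. *)
Definition sparse_negations (I : finType) (C : circuit I) (w : nat) : nat :=
  count (fun i => if onth (gates C) i is Some (NotGate j) then
                    orientation_weight (gate_fun C j)
                    + orientation_weight (gate_fun C i) <= w
                  else false)
        (iota 0 (size (gates C))).

Definition edge (n : nat) : finType := {e : {set 'I_n} | #|e| == 2}.

Lemma card_edge (n : nat) : #|edge n| = 'C(n, 2).
Proof. by rewrite card_sig -[in RHS](card_ord n) -card_draws cardsE. Qed.

Definition CLIQUE (n s : nat) (x : {ffun edge n -> bool}) : bool :=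
  [exists K : {set 'I_n},
     (#|K| == s) && [forall e : edge n, (val e \subset K) ==> x e]].

Definition log2 (R : realType) (x : R) : R := (ln x / ln 2)%R.

(* Main.v *)
(** A negation gate with sparse orientations only depends on [w] edges, so all
    chosen sparse gates become constant once the vertices of at most [k w] edges
    are isolated.  The other [l] negation gates and the output are treated in
    topological order: when a gate is reached, all earlier negations are constant
    on the inputs still allowed, so the input of the gate is a monotone formula
    of small depth, and a further restriction makes it constant.  The allowed
    inputs are always a fixed graph [g] plus an arbitrary graph on a vertex set
    [W] that is independent in [g].  A shallow monotone formula either rejects the
    complete graph on a large subset of [W], and then vanishes on all graphs
    inside it, or accepts a complete [p]-partite graph on [W], and then is 1 on
    everything above it, in which case we continue inside a large colour class.
    After [l + 1] rounds [g] still has a colouring with fewer than [s] colours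
    while [W] has at least [s] vertices, so the output is not constant.

    The dichotomy is a Karchmer-Wigderson game in the style of Goldmann and
    Hastad: Alice has a transversal [S] of blocks (a clique), Bob has a colouring
    [chi], and they look for two vertices of [S] of the same colour.  As long as
    few bits have been exchanged, the vertices that Alice is forced to contain can
    be given distinct colours by Bob, and so no edge is an answer. *)

Require Import Defs.
From mathcomp Require Import all_boot all_order all_algebra.
From mathcomp Require Import all_classical all_reals all_analysis.
From mathcomp Require Import fintype finset zify lra.

Set Implicit Arguments.
Unset Strict Implicit.
Unset Printing Implicit Defensive.

Import Order.TTheory GRing.Theory Num.Theory.

(** * Restrictions of sets of functions *)

Section Restriction.
Variables D E : finType.
Implicit Types (A : {set {ffun D -> E}}) (F H : {set D}) (f g : {ffun D -> E}).

Definition agree_on H f g : bool := [forall v in H, f v == g v].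

Lemma agree_onP H f g : reflect {in H, f =1 g} (agree_on H f g).
Proof.
apply: (iffP forall_inP) => fg v vH; first exact/eqP/fg.
by apply/eqP/fg.
Qed.

Definition agreeing A H g : {set {ffun D -> E}} := [set f in A | agree_on H f g].

Definition constant_on F A := forall f g, f \in A -> g \in A -> {in F, f =1 g}.

(** A blockwise min-entropy condition: for uniform [f] in [A], no pattern on a nonempty set [H]
    outside [F] has probability above [1 / theta ^ #|H|]. *)
Definition spread theta F A := forall H g, H != set0 -> [disjoint H & F] ->
  #|agreeing A H g| * theta ^ #|H| <= #|A|.

Lemma agreeing_subset A H g : agreeing A H g \subset A.
Proof. by apply/subsetP => f; rewrite inE => /andP[]. Qed.

Lemma constant_on_card F A : constant_on F A -> #|A| * #|E| ^ #|F| <= #|E| ^ #|D|.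
Proof.
move=> constA; have [->|[f fA]] := set_0Vmem A; first by rewrite cards0.
pose P v : pred E := if v \in F then pred1 (f v) else predT.
have subA : #|A| <= #|E| ^ #|~: F|.
  have -> : #|E| ^ #|~: F| = #|family P|.
    rewrite card_family foldrE big_map big_enum /= (bigID (mem F)) /=.
    rewrite big1 => [|v vF]; last by rewrite /P vF card1.
    rewrite mul1n (eq_bigr (fun=> #|E|)); last by move=> v /negPf vF; rewrite /P vF.
    by rewrite prod_nat_const; congr (_ ^ _); apply: eq_card => v; rewrite !inE.
  apply/subset_leq_card/subsetP => g gA; apply/familyP => v; rewrite /P.
  by case: ifP => // vF; rewrite inE; apply/eqP/constA.
rewrite (leq_trans (leq_mul subA (leqnn _)))// -expnD addnC.
by rewrite cardsC.
Qed.

Lemma agreeing_constant A H g : constant_on H (agreeing A H g).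
Proof.
move=> f f'; rewrite !inE => /andP[_ /agree_onP fg] /andP[_ /agree_onP f'g] v vH.
by rewrite fg ?f'g.
Qed.

Lemma spread_setT theta F : theta <= #|E| -> spread theta F [set: {ffun D -> E}].
Proof.
move=> le_theta H g H0 _; rewrite cardsT card_ffun.
apply: leq_trans (constant_on_card (@agreeing_constant setT H g)).
by rewrite leq_mul2l leq_exp2r ?le_theta ?orbT // card_gt0.
Qed.

(* Fix values on a maximal set of further coordinates among those on which a
   restriction keeps at least a [1 / theta] fraction per coordinate. *)
Lemma exists_spread_restriction theta F A : 0 < theta -> A != set0 ->
  exists A' F', [/\ A' \subset A /\ A' != set0, F \subset F',
    constant_on (F' :\: F) A', #|A| * theta ^ #|F| <= #|A'| * theta ^ #|F'|
    & spread theta F' A'].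
Proof.
move=> theta0 A0.
have [f0 f0A] : exists f, f \in A by apply/set0Pn.
pose ok (u : {set D} * {ffun D -> E}) :=
  [disjoint u.1 & F] && (#|A| <= #|agreeing A u.1 u.2| * theta ^ #|u.1|).
have ok0 : ok (set0, f0).
  rewrite /ok -setI_eq0 set0I eqxx /= cards0 expn0 muln1.
  apply/subset_leq_card/subsetP => f fA; rewrite inE fA.
  by apply/agree_onP => v; rewrite inE.
case: (@arg_maxnP _ _ ok (fun u => #|u.1|) ok0) => -[G g] /= /andP[/= GF leA] maxG.
exists (agreeing A G g), (F :|: G); split.
- split; first exact: agreeing_subset.
  apply: contraTneq leA => ->; rewrite cards0 mul0n -ltnNge.
  by rewrite card_gt0.
- exact: subsetUl.
- move=> f f' fA f'A v; rewrite !inE => /andP[/negPf vF]; rewrite vF /= => vG.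
  exact: (agreeing_constant fA f'A).
- rewrite cardsU; have -> : F :&: G = set0 by apply/eqP; rewrite setI_eq0 disjoint_sym.
  by rewrite cards0 subn0 expnD mulnCA mulnC leq_mul2l leA orbT.
(* A set [H] violating spreadness could be glued onto [G], against the maximality of [G]. *)
move=> H h H0 HFG; rewrite leqNgt; apply/negP => ltA.
have HF : [disjoint H & F] by apply: disjointWr HFG; rewrite subsetUl.
have HG : [disjoint H & G] by apply: disjointWr HFG; rewrite subsetUr.
have GH0 : G :&: H = set0 by apply/eqP; rewrite setI_eq0 disjoint_sym.
pose gh := [ffun v => if v \in H then h v else g v].
have /maxG /= : ok (G :|: H, gh).
  rewrite /ok /= -setI_eq0 setIUl setU_eq0 !setI_eq0 GF HF /= (leq_trans leA)//.
  rewrite cardsU GH0 cards0 subn0 expnD mulnCA mulnC.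
  rewrite leq_mul2l; apply/orP; right; apply: leq_trans (ltnW ltA) _.
  rewrite leq_mul2r; apply/orP; right; apply/subset_leq_card/subsetP => f.
  rewrite !inE -andbA => /and3P[-> /agree_onP fg /agree_onP fh] /=.
  apply/agree_onP => v; rewrite inE ffunE => /orP[vG|vH]; last by rewrite vH fh.
  rewrite fg//; case: ifP => // vH.
  by have : v \in G :&: H; [rewrite inE vG | rewrite GH0 inE].
rewrite cardsU GH0 cards0 subn0 -[X in _ <= X -> _]addn0 leq_add2l leqn0.
by rewrite cards_eq0 (negPf H0).
Qed.

(** Pigeonhole, one coordinate at a time: keeping the most frequent value costs at most a factor
    [#|E|]. This serves when the coordinates to be fixed are prescribed. *)
Lemma exists_popular_restriction U A : A != set0 ->
  exists2 f, f \in A & #|A| <= #|agreeing A U f| * #|E| ^ #|U|.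
Proof.
move=> A0; have [k] := ubnP #|U|; elim: k U A A0 => // k IH U A A0.
have [->|[v vU]] := set_0Vmem U.
  move=> _; have /set0Pn[f fA] := A0; exists f => //; rewrite cards0 muln1.
  apply/subset_leq_card/subsetP => g gA; rewrite inE gA.
  by apply/agree_onP => v; rewrite inE.
rewrite (cardsD1 v) vU /= => ltUk.
have [e leA] : exists e, #|A| <= #|[set f in A | f v == e]| * #|E|.
  have -> : #|A| = \sum_(e : E) #|[set f in A | f v == e]|.
    rewrite -sum1_card (partition_big (fun f : {ffun D -> E} => f v) xpredT) //=.
    apply: eq_bigr => e _; rewrite -sum1_card.
    by apply: eq_bigl => f; rewrite !inE.
  have /set0Pn[f0 _] := A0.
  pose F e := #|[set f in A | f v == e]|.
  case: (@arg_maxnP _ (f0 v) xpredT F isT) => e _ maxe.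
  exists e; rewrite mulnC -sum_nat_const; apply: leq_sum => e' _; exact: maxe.
have Ae0 : [set f in A | f v == e] != set0.
  by apply: contraNneq A0 => Ae; rewrite -cards_eq0 -leqn0 (leq_trans leA)// Ae cards0.
have [f] := IH (U :\ v) _ Ae0 ltUk; rewrite inE => /andP[fA /eqP fve] leAe.
exists f => //; apply: (leq_trans leA); rewrite add1n expnSr mulnA leq_mul2r.
apply/orP; right; apply: (leq_trans leAe); rewrite leq_mul2r.
apply/orP; right; apply/subset_leq_card/subsetP => g.
rewrite !inE -andbA => /and3P[-> /eqP gve /agree_onP gf] /=.
apply/agree_onP => u uU; have [->|uv] := eqVneq u v; first by rewrite gve.
by apply: gf; rewrite !inE uv.
Qed.

End Restriction.

(** * The clique-colouring game *)

Inductive formula (I : Type) : Type :=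
| Var of I
| Const of bool
| And of formula I & formula I
| Or of formula I & formula I.

Fixpoint feval (I : finType) (x : {ffun I -> bool}) (phi : formula I) : bool :=
  match phi with
  | Var i => x i
  | Const c => c
  | And phi1 phi2 => feval x phi1 && feval x phi2
  | Or phi1 phi2 => feval x phi1 || feval x phi2
  end.

Fixpoint fdepth (I : Type) (phi : formula I) : nat :=
  match phi with
  | Var _ | Const _ => 0
  | And phi1 phi2 | Or phi1 phi2 => (maxn (fdepth phi1) (fdepth phi2)).+1
  end.

Lemma feval_mono (I : finType) (phi : formula I) (x y : {ffun I -> bool}) :
  (forall i, x i -> y i) -> feval x phi -> feval y phi.
Proof.
move=> xy; elim: phi => //= [phi1 IH1 phi2 IH2|phi1 IH1 phi2 IH2].
  by case/andP => /IH1 -> /IH2 ->.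
by case/orP => [/IH1 ->|/IH2 ->] //; rewrite orbT.
Qed.

Lemma card_bigcup_le (I X : finType) (P : pred I) (G : I -> {set X}) :
  #|\bigcup_(i | P i) G i| <= \sum_(i | P i) #|G i|.
Proof.
elim/big_rec2: _ => [|i m U _ leU]; first by rewrite cards0.
by apply: leq_trans (leq_card_setU _ _) _; rewrite leq_add2l.
Qed.

Section Game.
Variables (J E K : finType) (d b r : nat).
Hypotheses (d_gt0 : 0 < d) (b_ge : 8 * d <= b) (r_ge : 4 * d <= r).
Hypotheses (cardE : #|E| = b ^ 2) (cardK : #|K| = r ^ 4).

Implicit Types (A : {set {ffun J -> E}}) (Q : {set {ffun J * E -> K}}).
Implicit Types (T : {set J}) (F : {set J * E}).

(* [beta] bits have been exchanged; Alice is forced to contain the vertices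
   [(i, S0 i)] for [i] in [T], and Bob's colours are known on [F] only.  In
   [alice_large] a bit costs a factor 4, half of which pays for avoiding the
   vertices of [F] outside [T]; in [bob_large] a vertex of [T] costs [r ^ 4], since
   its colour is chosen by averaging over all colours, and the other vertices of
   [F] cost [r ^ 3] each.  Comparison with the trivial upper bounds on [#|A|] and
   [#|Q|] then bounds [T] and [F]. *)
Record clean_state (beta : nat) A Q T F (S0 : {ffun J -> E}) : Prop := CleanState {
  alice_mem : S0 \in A;
  alice_constant : constant_on T A;
  alice_spread : spread b T A;
  bob_nonempty : Q != set0;
  bob_constant : constant_on F Q;
  bob_spread : spread (r ^ 3) F Q;
  fixed_coloured : forall i, i \in T -> (i, S0 i) \in F;
  fixed_distinct : forall chi i j, chi \in Q -> i \in T -> j \in T -> i != j ->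
    chi (i, S0 i) != chi (j, S0 j);
  alice_large : (b ^ 2) ^ #|J| <= #|A| * 4 ^ beta * b ^ #|T|;
  bob_large : (r ^ 4) ^ #|{: J * E}| * (r ^ 3) ^ #|T|
    <= #|Q| * 2 ^ beta * (r ^ 4) ^ #|T| * (r ^ 3) ^ #|F|
}.

Let b_gt0 : 0 < b. Proof. by lia. Qed.
Let r_gt0 : 0 < r. Proof. by lia. Qed.

(** The upper bound on a set constant on [T] turns the lower bound into [b ^ #|T| <= 4 ^ beta], and
    [b] exceeds 4. *)
Lemma alice_fixed_le beta A T : A != set0 -> constant_on T A ->
  (b ^ 2) ^ #|J| <= #|A| * 4 ^ beta * b ^ #|T| -> #|T| <= beta.
Proof.
move=> A0 /constant_on_card; rewrite cardE => ub lb.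
have := leq_trans ub lb.
rewrite -mulnA leq_pmul2l ?card_gt0 // -expnM mul2n -addnn expnD.
rewrite leq_pmul2r ?expn_gt0 ?b_gt0 // => le4.
rewrite -(@leq_exp2l 4) // (leq_trans _ le4) //.
by case: #|T| => // t; rewrite leq_exp2r //; lia.
Qed.

(** The gap between [r ^ 4] and [r ^ 3] leaves one factor [r] per vertex, so
    [r ^ #|F| <= 2 ^ beta * r ^ #|T|], and [r] exceeds 2. *)
Lemma bob_fixed_le beta Q T F : Q != set0 -> constant_on F Q ->
  (r ^ 4) ^ #|{: J * E}| * (r ^ 3) ^ #|T|
    <= #|Q| * 2 ^ beta * (r ^ 4) ^ #|T| * (r ^ 3) ^ #|F| ->
  #|F| <= #|T| + beta.
Proof.
move=> Q0 /constant_on_card; rewrite cardK => ub lb.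
have : #|Q| * ((r ^ 4) ^ #|F| * (r ^ 3) ^ #|T|) <=
       #|Q| * (2 ^ beta * (r ^ 4) ^ #|T| * (r ^ 3) ^ #|F|).
  by rewrite !mulnA (leq_trans _ lb) // leq_mul2r ub orbT.
rewrite leq_pmul2l ?card_gt0 // -!expnM.
move: #|F| #|T| => f t.
rewrite (_ : 4 * f = f + 3 * f)%N; last by lia.
rewrite (_ : 4 * t = t + 3 * t)%N; last by lia.
rewrite (expnD r f (3 * f)) (expnD r t (3 * t)) => le1.
have le2 : r ^ f * (r ^ (3 * t) * r ^ (3 * f)) <=
           2 ^ beta * r ^ t * (r ^ (3 * t) * r ^ (3 * f)).
  by rewrite !mulnA in le1 *; rewrite [X in X <= _]mulnAC.
move: le2; rewrite leq_pmul2r ?muln_gt0 ?expn_gt0 ?r_gt0 // => le2.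
rewrite leqNgt; apply/negP => lt_f.
have : r ^ (t + beta).+1 <= 2 ^ beta * r ^ t.
  by apply: leq_trans le2; rewrite leq_exp2l //; lia.
rewrite expnS expnD mulnA mulnAC leq_pmul2r ?expn_gt0 ?r_gt0 //.
apply/negP; rewrite -ltnNge.
have le_r : 2 ^ beta <= r ^ beta by case: (beta) => // k; rewrite leq_exp2r //; lia.
apply: leq_ltn_trans le_r _; rewrite -[X in X < _]mul1n ltn_pmul2r ?expn_gt0 ?r_gt0 //.
lia.
Qed.

(** If just one of the two colours is free, it must hit a fixed value, which has probability at most
    [1 / r ^ 3]. If both are free, each of the [r ^ 4] common colours has probability at most
    [1 / r ^ 6]. *)
Lemma collision_card F Q (u v : J * E) :
  Q != set0 -> constant_on F Q -> spread (r ^ 3) F Q -> u != v ->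
  ~~ ((u \in F) && (v \in F)) -> #|[set chi in Q | chi u == chi v]| * r ^ 2 <= #|Q|.
Proof.
move=> /set0Pn[chi0 chi0Q] constQ spreadQ.
wlog vF : u v / v \notin F => [wlog_vF uv|uv _].
  rewrite negb_and => /orP[uF|vF]; last by apply: wlog_vF; rewrite // negb_and vF orbT.
  rewrite (_ : [set _ in Q | _] = [set chi in Q | chi v == chi u]); last first.
    by apply/finset.setP => chi; rewrite !inE eq_sym.
  by apply: wlog_vF; rewrite // 1?eq_sym// negb_and uF orbT.
have [uF|uF] := boolP (u \in F).
  have := spreadQ [set v] [ffun=> chi0 u].
  rewrite -card_gt0 cards1 disjoints1 => /(_ isT vF); apply: leq_trans.
  apply: leq_mul; last by rewrite expn1 leq_exp2l //; lia.
  apply/subset_leq_card/subsetP => chi; rewrite !inE => /andP[chiQ /eqP chiuv].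
  rewrite chiQ; apply/agree_onP => w; rewrite inE ffunE => /eqP ->.
  by rewrite -chiuv; apply: constQ.
have uvF : [disjoint [set u; v] & F].
  by rewrite -setI_eq0 setIUl setU_eq0 !setI_eq0 !disjoints1 uF.
have card_uv c : #|agreeing Q [set u; v] [ffun=> c]| * r ^ 6 <= #|Q|.
  have := spreadQ [set u; v] [ffun=> c].
  by rewrite -card_gt0 cards2 uv -expnM; apply.
rewrite -(@leq_pmul2r (r ^ 4)) ?expn_gt0 ?r_gt0 // -mulnA -expnD.
have /subset_leq_card leU : [set chi in Q | chi u == chi v] \subset
    \bigcup_(c : K) agreeing Q [set u; v] [ffun=> c].
  apply/subsetP => chi; rewrite inE => /andP[chiQ /eqP chiuv].
  apply/bigcupP; exists (chi u) => //; rewrite inE chiQ; apply/agree_onP => w.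
  by rewrite !inE ffunE => /orP[] /eqP ->.
apply: leq_trans (leq_mul leU (leqnn _)) _.
apply: leq_trans (leq_mul (card_bigcup_le _ _) (leqnn _)) _.
rewrite big_distrl /= mulnC -cardK -sum_nat_const.
by apply: leq_sum => c _; apply: card_uv.
Qed.

(** The factor 2 lost to Bob's bit is paid by [beta]; spreadness of his side is restored by fixing
    further colours, and Alice's forced vertices stay the same. *)
Lemma bob_step beta A Q T F S0 Q1 : clean_state beta A Q T F S0 ->
  Q1 \subset Q -> #|Q| <= 2 * #|Q1| ->
  exists Q' F', Q' \subset Q1 /\ clean_state beta.+1 A Q' T F' S0.
Proof.
case=> S0A constA spreadA Q0 constQ spreadQ fixF fixD largeA largeQ subQ1 leQ1.
have Q10 : Q1 != set0.
  by rewrite -card_gt0; rewrite -card_gt0 in Q0; lia.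
have r30 : 0 < r ^ 3 by rewrite expn_gt0 r_gt0.
have [Q' [F' [[subQ' Q'0] subF constF' leQ' spreadQ']]] :=
  @exists_spread_restriction _ _ (r ^ 3) F Q1 r30 Q10.
have subQ : Q' \subset Q by apply: subset_trans subQ1.
exists Q', F'; split => //; split => //.
- move=> f g fQ gQ v vF'; have [vF|vF] := boolP (v \in F).
    by apply: constQ => //; apply: (subsetP subQ).
  by apply: constF' => //; rewrite inE vF.
- by move=> i /fixF; apply: (subsetP subF).
- by move=> chi i j /(subsetP subQ); apply: fixD.
- apply: leq_trans largeA _; rewrite leq_mul2r leq_mul2l.
  by rewrite leq_exp2l // leqnSn !orbT.
apply: leq_trans largeQ _; rewrite (expnS 2).
have le2 : #|Q| * (r ^ 3) ^ #|F| <= 2 * #|Q'| * (r ^ 3) ^ #|F'|.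
  by apply: leq_trans (leq_mul leQ1 (leqnn _)) _; rewrite -!mulnA leq_mul2l leQ'.
move: le2 {leQ'}; move: (2 ^ beta) ((r ^ 4) ^ _) ((r ^ 3) ^ #|F|) ((r ^ 3) ^ #|F'|).
move: #|Q| #|Q'| => q q' t x y z le2.
have -> : q * t * x * y = q * y * (t * x) by clear; lia.
have -> : q' * (2 * t) * x * z = 2 * q' * z * (t * x) by clear; lia.
by rewrite leq_mul2r le2 orbT.
Qed.

(** Restoring Alice's spreadness may force new vertices. They are kept outside [F], so their colours
    are still free, and Bob can first discard collisions and then fix these colours. *)
Lemma alice_step beta A Q T F S0 A1 : beta < d -> clean_state beta A Q T F S0 ->
  A1 \subset A -> #|A| <= 2 * #|A1| ->
  exists A' Q' T' F' S', [/\ A' \subset A1, Q' \subset Q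
    & clean_state beta.+1 A' Q' T' F' S'].
Proof.
move=> lt_beta [S0A constA spreadA Q0 constQ spreadQ fixF fixD largeA largeQ] subA1 leA1.
have A0 : A != set0 by apply/set0Pn; exists S0.
have leT := alice_fixed_le A0 constA largeA.
have leF := bob_fixed_le Q0 constQ largeQ.
(* Each vertex of [F] outside [T] lies in at most a [1 / b] fraction of [A]. As [#|F| <= 2 * d] and
   [b >= 8 * d], avoiding them all loses at most a quarter of [A], out of the half that [A1]
   provides. *)
pose hits (S : {ffun J -> E}) := [exists i, (i \notin T) && ((i, S i) \in F)].
pose A2 := [set S in A1 | ~~ hits S].
have leA2 : #|A| <= 4 * #|A2|.
  have leD : #|A1 :\: A2| * b <= #|F| * #|A|.
    have /subset_leq_card leU : A1 :\: A2 \subset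
        \bigcup_(v in [set v in F | v.1 \notin T]) [set S in A | S v.1 == v.2].
      apply/subsetP => S; rewrite !inE negb_and negbK andb_orl.
      case/orP => /andP[]; first by move/negPf => ->.
      case/existsP => i /andP[iT iF] SA1.
      apply/bigcupP; exists (i, S i); rewrite !inE /= ?iF ?iT //.
      by rewrite eqxx (subsetP subA1).
    apply: leq_trans (leq_mul (leq_trans leU (card_bigcup_le _ _)) (leqnn _)) _.
    rewrite big_distrl /=; apply: (@leq_trans (\sum_(v in [set v in F | v.1 \notin T]) #|A|)).
      apply: leq_sum => -[i a]; rewrite !inE /= => /andP[_ iT].
      have := spreadA [set i] [ffun=> a]; rewrite -card_gt0 cards1 disjoints1.
      move/(_ isT iT); apply: leq_trans; rewrite expn1 leq_mul2r; apply/orP; right.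
      apply/subset_leq_card/subsetP => S; rewrite !inE => /andP[-> /eqP Si] /=.
      by apply/agree_onP => j; rewrite inE ffunE => /eqP ->.
    rewrite sum_nat_const leq_mul2r; apply/orP; right; apply/subset_leq_card/subsetP.
    by move=> v; rewrite inE => /andP[].
  have cardA1 : #|A1| = #|A2| + #|A1 :\: A2|.
    rewrite -(cardsID A2 A1); congr (_ + _); apply: eq_card => S.
    by rewrite !inE andbA andbb.
  have le8 : #|A1 :\: A2| * (8 * d) <= 2 * d * #|A|.
    apply: leq_trans (leq_trans leD _); first by rewrite leq_mul2l b_ge orbT.
    by rewrite leq_mul2r; apply/orP; right; lia.
  have : #|A1 :\: A2| * 4 <= #|A|.
    have d2 : 0 < 2 * d by lia.
    by rewrite -(leq_pmul2l d2); move: le8; move: #|_| #|_| => ? ?; lia.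
  lia.
have A20 : A2 != set0 by move: A0 leA2; rewrite -!card_gt0; lia.
have [A' [T' [[subA' A'0] subT constT' leA' spreadA']]] :=
  exists_spread_restriction T b_gt0 A20.
have subA2 : A2 \subset A1 by apply/subsetP => S; rewrite inE => /andP[].
have subA'1 : A' \subset A1 by apply: subset_trans subA2.
have subA : A' \subset A by apply: subset_trans subA1.
have constA' : constant_on T' A'.
  move=> f g fA gA i iT'; have [iT|iT] := boolP (i \in T).
    by apply: constA => //; apply: (subsetP subA).
  by apply: constT' => //; rewrite inE iT.
have largeA' : (b ^ 2) ^ #|J| <= #|A'| * 4 ^ beta.+1 * b ^ #|T'|.
  apply: leq_trans largeA _; rewrite mulnAC [X in _ <= X]mulnAC expnS mulnA.
  rewrite leq_mul2r; apply/orP; right.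
  apply: leq_trans (leq_mul leA2 (leqnn _)) _.
  by rewrite -mulnA [X in _ <= X]mulnC leq_mul2l.
have leT' := alice_fixed_le A'0 constA' largeA'.
have /set0Pn[S1 S1A'] := A'0.
have S1T i : i \in T -> S1 i = S0 i by apply: constA => //; apply: (subsetP subA).
have S1F i : i \notin T -> (i, S1 i) \notin F.
  move=> iT; have := subsetP subA' _ S1A'; rewrite inE => /andP[_].
  by rewrite negb_exists => /forallP/(_ i); rewrite iT.
(* Two forced vertices that both lie in [F] come from [T] and already differ in colour. Each of the
   at most [d ^ 2] other pairs collides with probability at most [1 / r ^ 2], so at most 1/16 of [Q]
   is lost. *)
pose Q1 := [set chi in Q | [forall i in T', forall j in T',
   (i != j) ==> (chi (i, S1 i) != chi (j, S1 j))]].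
have leQ1 : #|Q| <= 2 * #|Q1|.
  have /subset_leq_card leU : Q :\: Q1 \subset
     \bigcup_(v in [set v in setX T' T' | v.1 != v.2])
       [set chi in Q | chi (v.1, S1 v.1) == chi (v.2, S1 v.2)].
    apply/subsetP => chi; rewrite !inE negb_and andb_orl.
    case/orP => /andP[]; first by move/negPf => ->.
    case/forall_inPn => i iT' /forall_inPn[j jT']; rewrite negb_imply negbK.
    case/andP => ij chiij chiQ.
    by apply/bigcupP; exists (i, j); rewrite !inE /= ?iT' ?jT' ?chiQ.
  have leD : #|Q :\: Q1| * r ^ 2 <= #|T'| * #|T'| * #|Q|.
    apply: leq_trans (leq_mul (leq_trans leU (card_bigcup_le _ _)) (leqnn _)) _.
    rewrite big_distrl /= -cardsX.
    apply: (@leq_trans (\sum_(v in [set v in setX T' T' | v.1 != v.2]) #|Q|)).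
      apply: leq_sum => -[i j]; rewrite !inE /= => /andP[/andP[iT' jT'] ij].
      have [/andP[iF jF]|nF] := boolP (((i, S1 i) \in F) && ((j, S1 j) \in F)).
        have iT : i \in T by apply: contraTT iF; apply: S1F.
        have jT : j \in T by apply: contraTT jF; apply: S1F.
        rewrite (_ : [set _ in Q | _] = set0) ?cards0 //.
        apply/finset.setP => chi; rewrite !inE !S1T //; apply/negP => /andP[chiQ].
        by apply/negP; apply: fixD.
      by apply: (collision_card Q0 constQ spreadQ) => //; apply: contraNneq ij => -[->].
    rewrite sum_nat_const leq_mul2r; apply/orP; right; apply/subset_leq_card/subsetP.
    by move=> v; rewrite inE => /andP[].
  have cardQ : #|Q| = #|Q1| + #|Q :\: Q1|.
    rewrite -(cardsID Q1 Q); congr (_ + _); apply: eq_card => S.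
    by rewrite !inE andbA andbb.
  have le16 : #|Q :\: Q1| * (16 * (d * d)) <= d * d * #|Q|.
    apply: leq_trans (leq_trans leD _).
      rewrite leq_mul2l; apply/orP; right.
      by rewrite (_ : 16 * (d * d) = (4 * d) ^ 2) ?leq_exp2r // expnMn -mulnn.
    by rewrite leq_mul2r; apply/orP; right; apply: leq_mul; apply: leq_trans leT' _.
  have : #|Q :\: Q1| * 16 <= #|Q|.
    have d2 : 0 < d * d by rewrite muln_gt0 d_gt0.
    by rewrite -(leq_pmul2l d2); move: le16; move: #|_| #|_| => q q1; clear; lia.
  by move: cardQ; clear; lia.
have Q10 : Q1 != set0 by move: Q0 leQ1; rewrite -!card_gt0; clear; lia.
(* The newly forced vertices receive their most popular colours, at the price [r ^ 4] each that
   [bob_large] allows for members of [T]. *)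
pose U := [set (i, S1 i) | i in T' :\: T].
have cardU : #|T'| = #|T| + #|U|.
  rewrite card_imset; last by move=> i j [].
  by rewrite -(cardsID T T') (setIidPr subT).
have [chi1 chi1Q1 leQ2] := exists_popular_restriction U Q10.
pose Q2 := agreeing Q1 U chi1.
have Q20 : Q2 != set0.
  by apply/set0Pn; exists chi1; rewrite inE chi1Q1; apply/agree_onP.
have r30 : 0 < r ^ 3 by rewrite expn_gt0 r_gt0.
have [Q' [F' [[subQ' Q'0] subF constF' leQ' spreadQ']]] :=
  exists_spread_restriction (F :|: U) r30 Q20.
have subQ21 : Q2 \subset Q1 by apply: agreeing_subset.
have subQ1 : Q1 \subset Q by apply/subsetP => chi; rewrite inE => /andP[].
have subQ'1 : Q' \subset Q1 by apply: subset_trans subQ21.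
have subQ : Q' \subset Q by apply: subset_trans subQ1.
have FU0 : F :&: U = set0.
  apply/eqP; rewrite setI_eq0 disjoint_sym; apply/pred0P => v /=.
  apply/negP => /andP[/imsetP[i]]; rewrite inE => /andP[iT _] ->.
  by apply/negP; apply: S1F.
exists A', Q', T', F', S1; split => //; split => //.
- move=> f g fQ gQ v vF'; have [vF|vF] := boolP (v \in F).
    by apply: constQ => //; apply: (subsetP subQ).
  have [vU|vU] := boolP (v \in U).
    by apply: (@agreeing_constant _ _ Q1 U chi1) => //; apply: (subsetP subQ').
  by apply: constF' => //; rewrite !inE negb_or vF vU.
- move=> i iT'; apply: (subsetP subF); rewrite inE.
  have [iT|iT] := boolP (i \in T); first by rewrite S1T // fixF.
  by apply/orP; right; apply/imsetP; exists i; rewrite // inE iT.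
- move=> chi i j /(subsetP subQ'1); rewrite inE => /andP[_].
  by move=> /forall_inP chiT iT' jT' ij; apply: (implyP (forall_inP (chiT i iT') j jT')).
move: leQ'; rewrite cardsU FU0 cards0 subn0 cardU !expnD (expnS 2).
move: leQ2; rewrite cardK -/Q2; move: largeQ leQ1.
move: (2 ^ beta) ((r ^ 4) ^ #|T|) ((r ^ 4) ^ #|U|) ((r ^ 4) ^ _).
move: ((r ^ 3) ^ #|T|) ((r ^ 3) ^ #|U|) ((r ^ 3) ^ #|F|) ((r ^ 3) ^ #|F'|).
move: #|Q| #|Q1| #|Q2| #|Q'| => q q1 q2 q' tT tU tF tF' e pT pU N h0 h1 h2 h3.
apply: (@leq_trans (q * e * pT * tF * tU)).
  by rewrite mulnA leq_mul2r h0 orbT.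
apply: (@leq_trans (2 * (q2 * pU) * e * pT * tF * tU)).
  by rewrite !leq_mul2r; apply/orP; right; apply/orP; right; move: h1 h2; clear; lia.
have -> : 2 * (q2 * pU) * e * pT * tF * tU = q2 * (tF * tU) * (2 * pU * e * pT) by clear; lia.
have -> : q' * (2 * e) * (pT * pU) * tF' = q' * tF' * (2 * pU * e * pT) by clear; lia.
by rewrite leq_mul2r h3 orbT.
Qed.

Lemma clean_state0 : 0 < #|E| -> 0 < #|K| ->
  exists S0, clean_state 0 [set: {ffun J -> E}] [set: {ffun J * E -> K}] set0 set0 S0.
Proof.
move=> /card_gt0P[a _] /card_gt0P[c _].
exists [ffun=> a]; split.
- by rewrite inE.
- by move=> f g _ _ i; rewrite inE.
- by apply: spread_setT; rewrite cardE -mulnn leq_pmulr.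
- by apply/set0Pn; exists [ffun=> c]; rewrite inE.
- by move=> f g _ _ i; rewrite inE.
- by apply: spread_setT; rewrite cardK leq_exp2l //; lia.
- by move=> i; rewrite inE.
- by move=> chi i j _; rewrite inE.
- by rewrite cards0 cardsT card_ffun cardE !muln1.
by rewrite !cards0 cardsT card_ffun cardK !muln1.
Qed.

Variables (I : finType) (X : {ffun J -> E} -> {ffun I -> bool}).
Variable Y : {ffun J * E -> K} -> {ffun I -> bool}.
(** A variable can answer the game only as an edge [uv]: being 1 for Alice puts both ends into her
    transversal, and being 0 for Bob makes them equally coloured. *)
Hypothesis witness : forall e : I,
  (forall S chi, X S e -> Y chi e) \/
  exists u v : J * E, [/\ u != v, forall S, X S e -> S u.1 = u.2 /\ S v.1 = v.2
    & forall chi : {ffun J * E -> K}, chi u != chi v -> Y chi e].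

(** Descending the formula is the protocol: at a conjunction Bob names a conjunct false on at least
    half of [Q], at a disjunction Alice names a disjunct true on at least half of [A]. At a
    variable, both ends of the edge are forced, hence distinctly coloured. *)
Lemma clean_state_not_separated phi beta A Q T F S0 :
  clean_state beta A Q T F S0 -> beta + fdepth phi <= d ->
  (forall S, S \in A -> feval (X S) phi) ->
  (forall chi, chi \in Q -> ~~ feval (Y chi) phi) -> False.
Proof.
elim: phi beta A Q T F S0 => [e|c|phi1 IH1 phi2 IH2|phi1 IH1 phi2 IH2]
  beta A Q T F S0 clean /=.
- move=> _ acc rej; case: (clean) => S0A constA spreadA /set0Pn[chi chiQ] _ _ _ fixD _ _.
  case: (witness e) => [XY|[u [v [uv XS Ychi]]]].
    by have := rej _ chiQ; rewrite (XY _ _ (acc _ S0A)).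
  (* Were [w.1] outside [T], spreadness would give [#|A| * b <= #|A|]. *)
  have fixed w : (forall S, S \in A -> S w.1 = w.2) -> w.1 \in T.
    move=> Sw; apply: contraT => wT.
    have := spreadA [set w.1] S0; rewrite -card_gt0 cards1 disjoints1 => /(_ isT wT).
    rewrite (_ : agreeing _ _ _ = A) ?expn1.
      have : 0 < #|A| by apply/card_gt0P; exists S0.
      by nia.
    apply/finset.setP => S; rewrite inE; apply: andb_idr => SA.
    by apply/agree_onP => i; rewrite inE => /eqP ->; rewrite !Sw.
  have uT : u.1 \in T by apply: fixed => S /acc/XS[].
  have vT : v.1 \in T by apply: fixed => S /acc/XS[].
  have [S0u S0v] := XS _ (acc _ S0A).
  have uv1 : u.1 != v.1.
    apply: contraNneq uv => e1; apply/eqP.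
    by rewrite [u]surjective_pairing [v]surjective_pairing -S0u -S0v e1.
  have := fixD _ _ _ chiQ uT vT uv1; rewrite S0u S0v -!surjective_pairing.
  by move/Ychi; apply/negP/rej.
- move=> _ acc rej; case: clean => S0A _ _ /set0Pn[chi chiQ] _ _ _ _ _ _.
  by have := rej _ chiQ; rewrite (acc _ S0A).
- move=> le_d acc rej.
  have half : #|Q| <= 2 * #|[set chi in Q | ~~ feval (Y chi) phi1]| \/
              #|Q| <= 2 * #|[set chi in Q | ~~ feval (Y chi) phi2]|.
    suff : #|Q| <= #|[set chi in Q | ~~ feval (Y chi) phi1]| +
                   #|[set chi in Q | ~~ feval (Y chi) phi2]|.
      by move: #|_| #|_| #|_| => a a1 a2; clear; lia.
    apply: leq_trans (leq_card_setU _ _); apply/subset_leq_card/subsetP => chi chiQ.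
    by rewrite !inE chiQ /= -negb_and; apply: rej.
  case: half => half.
    have [|Q' [F' [subQ' clean']]] := bob_step clean _ half.
      by apply/subsetP => chi; rewrite inE => /andP[].
    apply: (IH1 _ _ _ _ _ _ clean'); first by lia.
      by move=> S /acc /andP[].
    by move=> chi /(subsetP subQ'); rewrite inE => /andP[].
  have [|Q' [F' [subQ' clean']]] := bob_step clean _ half.
    by apply/subsetP => chi; rewrite inE => /andP[].
  apply: (IH2 _ _ _ _ _ _ clean'); first by lia.
    by move=> S /acc /andP[].
  by move=> chi /(subsetP subQ'); rewrite inE => /andP[].
move=> le_d acc rej.
have lt_d : beta < d by lia.
have half : #|A| <= 2 * #|[set S in A | feval (X S) phi1]| \/
            #|A| <= 2 * #|[set S in A | feval (X S) phi2]|.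
  suff : #|A| <= #|[set S in A | feval (X S) phi1]| + #|[set S in A | feval (X S) phi2]|.
    by move: #|_| #|_| #|_| => a a1 a2; clear; lia.
  apply: leq_trans (leq_card_setU _ _); apply/subset_leq_card/subsetP => S SA.
  by rewrite !inE SA /=; apply: acc.
case: half => half.
  have [|A' [Q' [T' [F' [S' [subA' subQ' clean']]]]]] := alice_step lt_d clean _ half.
    by apply/subsetP => chi; rewrite inE => /andP[].
  apply: (IH1 _ _ _ _ _ _ clean'); first by lia.
    by move=> S /(subsetP subA'); rewrite inE => /andP[].
  by move=> chi /(subsetP subQ') /rej; rewrite negb_or => /andP[].
have [|A' [Q' [T' [F' [S' [subA' subQ' clean']]]]]] := alice_step lt_d clean _ half.
  by apply/subsetP => chi; rewrite inE => /andP[].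
apply: (IH2 _ _ _ _ _ _ clean'); first by lia.
  by move=> S /(subsetP subA'); rewrite inE => /andP[].
by move=> chi /(subsetP subQ') /rej; rewrite negb_or => /andP[].
Qed.

Theorem formula_not_separating phi : fdepth phi <= d ->
  (exists S, ~~ feval (X S) phi) \/ (exists chi, feval (Y chi) phi).
Proof.
move=> le_d; have [/existsP|] := boolP [exists S, ~~ feval (X S) phi]; first by left.
have [/existsP|] := boolP [exists chi, feval (Y chi) phi]; first by right.
rewrite !negb_exists => /forallP rej /forallP acc; exfalso.
have [||S0 clean] := clean_state0.
- by rewrite cardE expn_gt0 b_gt0.
- by rewrite cardK expn_gt0 r_gt0.
apply: (clean_state_not_separated clean le_d) => [S _|chi _]; last exact: rej.
by have := acc S; rewrite negbK.
Qed.

End Game.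

(** * Circuits as formulas *)

Section FoldRcons.
Variables (T U : Type) (F : seq U -> T -> U) (u0 : U).

Let folded (s : seq T) := foldl (fun vs g => rcons vs (F vs g)) [::] s.

Let folded_rcons s x : folded (rcons s x) = rcons (folded s) (F (folded s) x).
Proof. by rewrite /folded -cats1 foldl_cat. Qed.

Lemma size_foldl_rcons s : size (folded s) = size s.
Proof. by elim/last_ind: s => // s x IH; rewrite folded_rcons !size_rcons IH. Qed.

Lemma nth_foldl_rcons s i g : onth s i = Some g ->
  nth u0 (folded s) i = F (take i (folded s)) g.
Proof.
elim/last_ind: s => [|s x IH]; first by rewrite onth0n.
rewrite folded_rcons nth_rcons -cats1 onth_cat -[rcons _ _]cats1 take_cat size_foldl_rcons.
case: ltnP => [lt_i /IH //|le_i].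
case/onth1P => /eqP; rewrite subn_eq0 => ge_i ->.
have -> : i = size s by apply/eqP; rewrite eqn_leq ge_i le_i.
by rewrite eqxx subnn take0 cats0.
Qed.

End FoldRcons.

Section CircuitFormula.
Variables (I : finType) (C : circuit I).

Lemma nth_take_preds (U : Type) (u0 : U) vs i g j :
  onth (gates C) i = Some g -> j \in preds g -> nth u0 (take i vs) j = nth u0 vs j.
Proof. by move=> /(@preds_lt _ C)/allP lt_i /lt_i lt_ji; rewrite nth_take. Qed.

Lemma gate_funE i g x : onth (gates C) i = Some g ->
  gate_fun C i x = match g with
    | InputGate e => x e
    | NotGate j => ~~ gate_fun C j x
    | AndGate js => all (fun j => gate_fun C j x) js
    | OrGate js => has (fun j => gate_fun C j x) js
    end.
Proof.
move=> gi; rewrite {1}/gate_fun (nth_foldl_rcons (@gate_value I x) false gi).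
have := @nth_take_preds _ false (gate_values (gates C) x) i g ^~ gi.
case: g gi => //= [j|js|js] gi nthE; first by rewrite nthE ?inE.
  by apply: eq_in_all => j jjs; apply: nthE.
by apply: eq_in_has => j jjs; apply: nthE.
Qed.

Definition gate_depth i := nth 0 (gate_depths (gates C)) i.

Lemma gate_depth_preds i g j : onth (gates C) i = Some g -> j \in preds g ->
  gate_depth j < gate_depth i.
Proof.
move=> gi jg; rewrite {2}/gate_depth.
rewrite (nth_foldl_rcons (fun ds g => \max_(j <- preds g) (nth 0 ds j).+1) 0 gi).
by rewrite (big_rem j) //= (nth_take_preds _ _ gi) // leq_maxl.
Qed.

Definition constant_in (P : {ffun I -> bool} -> Prop) (f : {ffun I -> bool} -> bool) :=
  exists c, forall x, P x -> f x = c.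

(* Only negations of depth at most that of gate [i] are required to be constant:
   gates that do not lead to the output may be arbitrarily deep. *)
Lemma gate_formula (P : {ffun I -> bool} -> Prop) (i : nat) :
  (forall q j, q <= i -> gate_depth q <= gate_depth i ->
     onth (gates C) q = Some (NotGate I j) -> constant_in P (gate_fun C q)) ->
  i < size (gates C) ->
  exists2 phi, fdepth phi <= gate_depth i & forall x, P x -> feval x phi = gate_fun C i x.
Proof.
elim/ltn_ind: i => i IH notP lt_i.
case gi : (onth (gates C) i) => [g|]; last first.
  by move: lt_i; rewrite -onthTE gi.
have {}IH j : j \in preds g -> exists2 phi, fdepth phi <= gate_depth j
    & forall x, P x -> feval x phi = gate_fun C j x.
  move=> jg; have lt_ji : j < i := allP (preds_lt gi) j jg.
  have ltd := gate_depth_preds gi jg.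
  apply: IH => //; last exact: ltn_trans lt_i.
  move=> q k le_q le_d; apply: notP; first exact: leq_trans le_q (ltnW lt_ji).
  exact: leq_trans le_d (ltnW ltd).
have ltd := gate_depth_preds gi.
have fan := fan_in_le2 gi.
case: g gi IH ltd fan => [e|j|js|js] gi IH ltd.
- by move=> _; exists (Var e) => // x _; rewrite (gate_funE x gi).
- by move=> _; have [c Pc] := notP _ _ (leqnn _) (leqnn _) gi; exists (Const I c) => // x /Pc.
- case: js gi IH ltd => [|j1 [|j2 []]] //= gi IH ltd _.
  + by exists (Const I true) => // x _; rewrite (gate_funE x gi).
  + have [phi le_phi phiE] := IH j1 (mem_head _ _); exists phi.
      by rewrite (leq_trans le_phi) // ltnW // ltd ?mem_head.
    by move=> x Px; rewrite (gate_funE x gi) /= andbT phiE.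
  + have [phi1 le1 phi1E] := IH j1 (mem_head _ _).
    have j2g : j2 \in [:: j1; j2] by rewrite !inE eqxx orbT.
    have [phi2 le2 phi2E] := IH j2 j2g; exists (And phi1 phi2) => /=.
      by rewrite gtn_max (leq_ltn_trans le1) ?(leq_ltn_trans le2) // ltd ?mem_head.
    by move=> x Px; rewrite (gate_funE x gi) /= andbT phi1E ?phi2E.
case: js gi IH ltd => [|j1 [|j2 []]] //= gi IH ltd _.
+ by exists (Const I false) => // x _; rewrite (gate_funE x gi).
+ have [phi le_phi phiE] := IH j1 (mem_head _ _); exists phi.
    by rewrite (leq_trans le_phi) // ltnW // ltd ?mem_head.
  by move=> x Px; rewrite (gate_funE x gi) /= orbF phiE.
have [phi1 le1 phi1E] := IH j1 (mem_head _ _).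
have j2g : j2 \in [:: j1; j2] by rewrite !inE eqxx orbT.
have [phi2 le2 phi2E] := IH j2 j2g; exists (Or phi1 phi2) => /=.
  by rewrite gtn_max (leq_ltn_trans le1) ?(leq_ltn_trans le2) // ltd ?mem_head.
by move=> x Px; rewrite (gate_funE x gi) /= orbF phi1E ?phi2E.
Qed.

End CircuitFormula.

(** * Orientations at a negation gate *)

Lemma orientation_mono (I : finType) (f : {ffun I -> bool} -> bool)
    (beta x y : {ffun I -> bool}) : has_orientation f beta ->
  (forall i, x i -> y i) -> (forall i, beta i -> x i = y i) -> f x -> f y.
Proof.
case=> h hmono fE le_xy eq_xy; rewrite !fE; apply/implyP/hmono => -[i|i];
  rewrite !ffunE /=; apply/implyP; first exact: le_xy.
case betai : (beta i); last by rewrite !addbF; apply: le_xy.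
by rewrite eq_xy.
Qed.

(** With the coordinates of both orientations held fixed, [f] and its negation are both increasing
    in the remaining ones, so neither depends on them. *)
Lemma negation_junta (I : finType) (f g : {ffun I -> bool} -> bool) :
  (forall x, g x = ~~ f x) ->
  exists2 H : {set I}, #|H| <= orientation_weight f + orientation_weight g &
    forall x y : {ffun I -> bool}, {in H, x =1 y} -> g x = g y.
Proof.
move=> gE; have [of_ _] := min_orientationP f; have [og _] := min_orientationP g.
exists ([set i | min_orientation f i] :|: [set i | min_orientation g i]).
  exact: leq_card_setU.
suff le_g (x y : {ffun I -> bool}) :
    {in [set i | min_orientation f i] :|: [set i | min_orientation g i], x =1 y} ->
    (forall i, x i -> y i) -> g x = g y.
  (* Incomparable inputs are compared through their join. *)
  move=> x y xy; pose z : {ffun I -> bool} := [ffun i => x i || y i].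
  rewrite (le_g x z) ?(le_g y z) //.
  - by move=> i iH; rewrite ffunE xy // orbb.
  - by move=> i; rewrite ffunE => ->; rewrite orbT.
  - by move=> i iH; rewrite ffunE -xy // orbb.
  - by move=> i; rewrite ffunE => ->.
move=> xy le_xy; apply/idP/idP.
  by apply: (orientation_mono og) => // i oi; apply: xy; rewrite !inE oi orbT.
rewrite !gE; apply: contra.
by apply: (orientation_mono of_) => // i oi; apply: xy; rewrite !inE oi.
Qed.

Lemma exists_injection_into (X V : finType) (W : {set V}) : #|X| <= #|W| ->
  exists2 iota : X -> V, injective iota & forall x, iota x \in W.
Proof.
move=> le_XW; exists (fun x => enum_val (widen_ord le_XW (enum_rank x))).
  by move=> x y /enum_val_inj /(congr1 val) /= /val_inj /enum_rank_inj.
by move=> x; apply: enum_valP.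
Qed.

(** * Boards *)

Section Boards.
Variable n : nat.
Implicit Types (g x : {ffun edge n -> bool}) (W : {set 'I_n}).

(* A board is a family of inputs: the graphs that coincide with [g] outside [W].
   The colouring [kappa] bounds the clique number of [g] by [c + 1]. *)
Definition in_board g W x : Prop :=
  forall e : edge n, ~~ (val e \subset W) -> x e = g e.

Record board (c : nat) g W : Prop := Board {
  board_free : forall e : edge n, val e \subset W -> g e = false;
  board_colouring : exists kappa : 'I_n -> nat, [/\ forall v, kappa v <= c,
    forall v, v \in W -> kappa v = 0
    & forall e : edge n, g e -> {in val e &, injective kappa}]
}.

Lemma edgeP (e : edge n) : exists u v, u != v /\ val e = [set u; v].
Proof. exact/cards2P/(valP e). Qed.

(** The game is played on disjoint blocks placed inside [W]. Its two outcomes give either a clique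
    of the next board's size to shrink to, or a multipartite graph to add to [g]. *)
Lemma board_round d m c g W (phi : formula (edge n)) :
  0 < d -> fdepth phi <= d -> board c g W -> (4 * d) ^ 4 * m <= #|W| ->
  exists g' W', [/\ board (c + (4 * d) ^ 4) g' W', m <= #|W'|,
    forall x, in_board g' W' x -> in_board g W x
    & constant_in (in_board g' W') (fun x => feval x phi)].
Proof.
move=> d0 le_d [freeg [kappa [kappa_le kappaW kappa_inj]]] leW.
set p := (4 * d) ^ 4.
(* The game has [b = 8 * d] and [r = 4 * d]; the block size [b ^ 2] is chosen so that the blocks
   hold [4 * d ^ 2 * m * (8 * d) ^ 2 = (4 * d) ^ 4 * m] vertices, as many as [W] is known to
   have. *)
pose J := 'I_(4 * d ^ 2 * m); pose E := 'I_((8 * d) ^ 2); pose K := 'I_p.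
have cardJE : #|{: J * E}| = p * m.
  by rewrite card_prod !card_ord /p mulnAC !expnMn mulnACA -expnD.
have [|iota iota_inj iotaW] := @exists_injection_into (J * E)%type _ W.
  by rewrite cardJE.
pose X (S : {ffun J -> E}) : {ffun edge n -> bool} :=
  [ffun e => g e || (val e \subset [set iota (i, S i) | i : J])].
pose Y (chi : {ffun J * E -> K}) : {ffun edge n -> bool} :=
  [ffun e => g e ||
    [exists u, exists v, (val e == [set iota u; iota v]) && (chi u != chi v)]].
have wit (e : edge n) : (forall S chi, X S e -> Y chi e) \/
    exists u v : J * E, [/\ u != v, forall S, X S e -> S u.1 = u.2 /\ S v.1 = v.2
      & forall chi : {ffun J * E -> K}, chi u != chi v -> Y chi e].
  have [ge|ge] := boolP (g e); first by left=> S chi _; rewrite ffunE ge.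
  have [/existsP[u /existsP[v /andP[uv /eqP ve]]]|noe] :=
    boolP [exists u, exists v, (u != v) && (val e == [set iota u; iota v])].
    right; exists u, v; split=> // [S|chi chiuv]; last first.
      rewrite ffunE; apply/orP; right; apply/existsP; exists u; apply/existsP; exists v.
      by rewrite ve eqxx.
    rewrite ffunE (negPf ge) /= ve subUset !sub1set => /andP[].
    by move=> /imsetP[i _ /iota_inj ->] /imsetP[j _ /iota_inj ->].
  left=> S chi; rewrite !ffunE (negPf ge) /=.
  have [a [b [ab ve]]] := edgeP e; rewrite ve subUset !sub1set => /andP[].
  move=> /imsetP[i _ ai] /imsetP[j _ bj]; case/negP: noe.
  apply/existsP; exists (i, S i); apply/existsP; exists (j, S j).
  by rewrite ve ai bj eqxx andbT; apply: contraNneq ab => ij; rewrite ai bj ij.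
have [[S rejS]|[chi accchi]] := formula_not_separating d0 (leqnn (8 * d)) (leqnn (4 * d))
  (card_ord _) (card_ord _) wit le_d.
(* A rejected transversal becomes the new vertex set; every graph on the new board lies below [X S],
   so the monotone formula rejects it. *)
- exists g, [set iota (i, S i) | i : J].
  have subW : [set iota (i, S i) | i : J] \subset W.
    by apply/subsetP => _ /imsetP[i _ ->].
  split.
  + split; first by move=> e eW'; apply: freeg; apply: subset_trans eW' subW.
    exists kappa; split=> //; first by move=> v; rewrite (leq_trans (kappa_le v)) ?leq_addr.
    by move=> v /(subsetP subW); apply: kappaW.
  + rewrite card_imset ?card_ord ?leq_pmull ?muln_gt0 ?expn_gt0 ?d0 //.
    by move=> i j /iota_inj[].
  + move=> x xW' e eW; apply: xW'; apply: contra eW => eW'; exact: subset_trans eW' subW.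
  exists false => x xW'; apply: contraNF rejS; apply: feval_mono => e.
  rewrite ffunE; have [|eW'] := boolP (val e \subset _); first by rewrite orbT.
  by rewrite xW' // => ->.
(* One of the [p] colour classes on the [p * m] vertices has at least [m] members. *)
have [k lek] : exists k, m <= #|[set v | chi v == k]|.
  apply/existsP; apply: contraT; rewrite negb_exists => /forallP ltk.
  have p0 : 0 < p by rewrite expn_gt0 muln_gt0 d0.
  have m0 : 0 < m.
    by have := ltk (Ordinal p0); rewrite -ltnNge; apply: leq_ltn_trans.
  suff : #|{: J * E}| <= p * m.-1.
    by rewrite cardJE leq_pmul2l // -ltnS prednK ?ltnn.
  rewrite -sum1_card (partition_big (fun v => chi v) xpredT) //=.
  rewrite (_ : p * m.-1 = \sum_(k : K) m.-1); last by rewrite sum_nat_const card_ord.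
  apply: leq_sum => k _.
  have ltm := ltk k; rewrite -ltnNge in ltm.
  rewrite -ltnS prednK //; apply: leq_ltn_trans ltm.
  by rewrite -sum1_card; apply: eq_leq; apply: eq_bigl => v; rewrite inE.
pose W' := [set iota v | v in [set v | chi v == k]].
have subW : W' \subset W by apply/subsetP => _ /imsetP[v _ ->].
have memW' v : (iota v \in W') = (chi v == k) by rewrite mem_imset ?inE.
have YE (e : edge n) : Y chi e -> g e \/
    exists u v, val e = [set iota u; iota v] /\ chi u != chi v.
  rewrite ffunE => /orP[|/existsP[u /existsP[v /andP[/eqP ve uv]]]]; first by left.
  by right; exists u, v.
have freeY (e : edge n) : val e \subset W' -> Y chi e = false.
  move=> eW'; apply/negP => /YE[|[u [v [ve]]]].
    by rewrite freeg // (subset_trans eW' subW).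
  by move: eW'; rewrite ve subUset !sub1set !memW' => /andP[/eqP -> /eqP ->]; rewrite eqxx.
exists (Y chi), W'; split.
+ split=> //.
  (* The chosen class keeps colour 0, and the other classes get the fresh colours [c + 1] to
     [c + p], which no old vertex carries. *)
  pose kappa' w := if [pick v | iota v == w] is Some v then
    if chi v == k then 0 else c + (chi v).+1 else kappa w.
  have kappa'_iota v : kappa' (iota v) = if chi v == k then 0 else c + (chi v).+1.
    rewrite /kappa'; case: pickP => [u /eqP /iota_inj -> //|/(_ v)].
    by rewrite eqxx.
  have kappa'P w : (exists2 v, w = iota v & w \in W) \/ kappa' w = kappa w.
    rewrite /kappa'; case: pickP => [v /eqP <-|_]; last by right.
    by left; exists v.
  exists kappa'; split.
  * move=> w; have [[v wv _]|->] := kappa'P w; last first.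
      by rewrite (leq_trans (kappa_le w)) ?leq_addr.
    by rewrite wv kappa'_iota; case: ifP => // _; rewrite leq_add2l.
  * by move=> w /imsetP[v]; rewrite inE => vk ->; rewrite kappa'_iota vk.
  move=> e /YE[ge|[u [v [ve uv]]]] a b ae be.
    have inj := kappa_inj e ge a b ae be.
    have [[u au aW]|->] := kappa'P a; have [[v bv bW]|->] := kappa'P b => //.
    - by move=> _; apply: inj; rewrite !kappaW.
    - rewrite au kappa'_iota -au; case: ifP => _ kb; first by apply: inj; rewrite kappaW.
      by have := kappa_le b; rewrite -kb; clear; lia.
    - rewrite bv kappa'_iota -bv; case: ifP => _ ka; first by apply: inj; rewrite ka kappaW.
      by have := kappa_le a; rewrite ka; clear; lia.
  have kuv : kappa' (iota u) != kappa' (iota v).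
    rewrite !kappa'_iota; have [uk|_] := eqVneq (chi u) k; have [vk|_] := eqVneq (chi v) k.
    - by move: uv; rewrite uk vk eqxx.
    - by rewrite addnS.
    - by rewrite addnS.
    by rewrite eqn_add2l eqSS; apply: contraNneq uv => /val_inj ->.
  move: ae be; rewrite ve !inE => /orP[] /eqP -> /orP[] /eqP -> // /eqP.
    by rewrite (negPf kuv).
  by rewrite eq_sym (negPf kuv).
+ by rewrite card_imset.
+ move=> x xW' e eW; rewrite xW'; last by apply: contra eW => /subset_trans; apply.
  apply/idP/idP => [/YE[//|[u [v [ve _]]]]|ge]; last by rewrite ffunE ge.
  by case/negP: eW; rewrite ve subUset !sub1set !iotaW.
exists true => x xW'; apply: feval_mono accchi => e Ye.
by rewrite xW' //; apply/negP => /freeY; rewrite Ye.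
Qed.

Lemma board_weaken c c' g W : c <= c' -> board c g W -> board c' g W.
Proof.
move=> le_c [freeg [kappa [kappa_le kappaW kappa_inj]]]; split=> //.
by exists kappa; split=> // v; apply: leq_trans le_c.
Qed.

(** The graph [g] itself is coloured with at most [c + 1 < s] colours, while completing it on [W]
    creates a clique of size [s]. *)
Lemma board_clique c g W s : board c g W -> s <= #|W| -> c.+1 < s ->
  exists x y, [/\ in_board g W x, in_board g W y, ~~ CLIQUE s x & CLIQUE s y].
Proof.
case=> _ [kappa [kappa_le _ kappa_inj]] leW lt_s.
exists g, [ffun e : edge n => (val e \subset W) || g e]; split=> //.
- by move=> e /negPf eW; rewrite ffunE eW.
- apply/existsP => -[K /andP[/eqP cardK /forallP cliqueK]].
  have injK : {in K &, injective (fun v => inord (kappa v) : 'I_c.+1)}.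
    move=> a b aK bK /(congr1 val) /=; rewrite !inordK ?ltnS // => kab.
    apply/eqP; apply: contraT => ab.
    have ce : #|[set a; b]| == 2 by rewrite cards2 ab.
    have := cliqueK (@exist _ (fun e : {set 'I_n} => #|e| == 2) _ ce).
    rewrite /= subUset !sub1set aK bK /=.
    move/kappa_inj => /(_ a b) /=; rewrite !inE !eqxx orbT => /(_ isT isT kab) /eqP.
    by rewrite (negPf ab).
  have := max_card (mem [set (inord (kappa v) : 'I_c.+1) | v in K]).
  by rewrite card_in_imset // cardK card_ord leqNgt lt_s.
have /card_geqP[t [ut st tW]] := leW.
apply/existsP; exists [set v in t]; rewrite cardsE (card_uniqP ut) st eqxx /=.
apply/forallP => e; apply/implyP => et; rewrite ffunE; apply/orP; left.
apply: subset_trans et _; apply/subsetP => v; rewrite inE; exact: tW.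
Qed.

End Boards.

(** * Rounds over the negation gates *)

Lemma constant_in_sub (I : finType) (P P' : {ffun I -> bool} -> Prop) f :
  (forall x, P' x -> P x) -> constant_in P f -> constant_in P' f.
Proof. by move=> PP' [c Pc]; exists c => x /PP'; apply: Pc. Qed.

Section Rounds.
Variables (n : nat) (C : circuit (edge n)) (d : nat) (Z : seq nat).
Hypothesis d_gt0 : 0 < d.

Definition is_not (i : nat) : bool :=
  if onth (gates C) i is Some (NotGate _) then true else false.

(* [Z] lists the sparse negation gates that the initial board makes constant. *)
Definition dense_nots (i : nat) : nat :=
  count (fun q => is_not q && (q \notin Z)) (iota 0 i).

Lemma dense_notsS i : dense_nots i.+1 = dense_nots i + (is_not i && (i \notin Z)).
Proof. by rewrite /dense_nots -addn1 iotaD count_cat /= addn0. Qed.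

Lemma gate_round c g W i m : board c g W -> (4 * d) ^ 4 * m <= #|W| ->
  i < size (gates C) -> gate_depth C i <= d ->
  (forall q j, q <= i -> gate_depth C q <= d -> onth (gates C) q = Some (NotGate (edge n) j) ->
     constant_in (in_board g W) (gate_fun C q)) ->
  exists g' W', [/\ board (c + (4 * d) ^ 4) g' W', m <= #|W'|,
    forall x, in_board g' W' x -> in_board g W x
    & constant_in (in_board g' W') (gate_fun C i)].
Proof.
move=> bd leW lt_i le_d notc.
have [q j le_q le_qi gq|//|phi le_phi phiE] := @gate_formula _ C (in_board g W) i.
  by apply: (notc q j) => //; apply: leq_trans le_d.
have [g' [W' [bd' leW' sub' const']]] := board_round d_gt0 (leq_trans le_phi le_d) bd leW.
exists g', W'; split=> //; case: const' => b constb; exists b => x x'.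
by rewrite -phiE ?constb //; apply: sub'.
Qed.

(** Going through the gates in order, each negation outside [Z] of depth at most [d] takes one
    round, which costs a factor [(4 * d) ^ 4] in [W] and as many new colours. [L] is the total
    number of rounds budgeted. *)
Lemma exists_board_nots_constant (W0 : {set 'I_n}) (L s i : nat) :
  (forall q, q \in Z -> constant_in (in_board [ffun=> false] W0) (gate_fun C q)) ->
  ((4 * d) ^ 4) ^ L * s <= #|W0| -> i <= size (gates C) -> dense_nots i <= L ->
  exists g W, [/\ board (dense_nots i * (4 * d) ^ 4) g W,
    ((4 * d) ^ 4) ^ (L - dense_nots i) * s <= #|W|,
    forall x, in_board g W x -> in_board [ffun=> false] W0 x
    & forall q j, q < i -> gate_depth C q <= d ->
      onth (gates C) q = Some (NotGate (edge n) j) ->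
      constant_in (in_board g W) (gate_fun C q)].
Proof.
move=> constZ leW0; elim: i => [_ _|i IH lt_i].
  exists [ffun=> false], W0; split=> //; last by rewrite /dense_nots /= subn0.
  split; first by move=> e _; rewrite ffunE.
  by exists (fun=> 0); split=> // e; rewrite ffunE.
rewrite dense_notsS => leL.
have [||g [W [bd leW sub constW]]] := IH; [exact: ltnW|by lia|].
case gi : (onth (gates C) i) => [gt|]; last by move: lt_i; rewrite -onthTE gi.
have p0 : 0 < (4 * d) ^ 4 by rewrite expn_gt0 muln_gt0 d_gt0.
have [/andP[/andP[noti iZ] le_d]|trivial_i] :=
  boolP (is_not i && (i \notin Z) && (gate_depth C i <= d)).
  have [j gtE] : exists j, gt = NotGate (edge n) j.
    by move: noti; rewrite /is_not gi; case: (gt) => // j; exists j.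
  rewrite gtE in gi.
  have jg : j \in preds (NotGate (edge n) j) by rewrite inE.
  have lt_ji : j < i := allP (preds_lt gi) j jg.
  have lt_d := gate_depth_preds gi jg.
  rewrite noti iZ /= addn1 in leL *.
  (* The round is played on the input [j] of the negation, since all negations up to [j] of depth at
     most [d] are already constant. *)
  have leW' : (4 * d) ^ 4 * (((4 * d) ^ 4) ^ (L - (dense_nots i).+1) * s) <= #|W|.
    by rewrite mulnA -expnS subnSK.
  have [|q k le_q le_qd gq|g' [W' [bd' lew sub' const']]] :=
    gate_round bd leW' (ltn_trans lt_ji lt_i).
  - exact: leq_trans (ltnW lt_d) le_d.
  - by apply: (constW q k) => //; apply: leq_ltn_trans lt_ji.
  exists g', W'; split=> //.
  - by rewrite mulSn addnC.
  - by move=> x /sub'/sub.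
  move=> q k; rewrite ltnS leq_eqVlt => /predU1P[->|lt_q] qd gq; last first.
    by apply: (constant_in_sub sub'); apply: (constW q k).
  case: const' => b constb; exists (~~ b) => x x'.
  by rewrite (gate_funE x gi) constb.
(* No round is played here. If gate [i] is a negation outside [Z] that is too deep, it is still
   counted, and the bounds only become weaker. *)
exists g, W; split=> //.
- by apply: board_weaken bd; rewrite leq_mul2r leq_addr orbT.
- apply: leq_trans leW; rewrite leq_mul2r; apply/orP; right.
  by rewrite leq_pexp2l // leq_sub2l // leq_addr.
move=> q k; rewrite ltnS leq_eqVlt => /predU1P[->|lt_q] qd gq; last exact: (constW q k).
move: trivial_i; rewrite qd andbT /is_not gq /= negbK => iZ.
exact: constant_in_sub sub (constZ i iZ).
Qed.

End Rounds.

(** * The depth bound with explicit parameters *)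

Lemma count_onth (T : Type) (a : pred T) (s : seq T) :
  count a s = count (fun i => oapp a false (onth s i)) (iota 0 (size s)).
Proof. by elim: s => //= x s ->; rewrite -[1]addn0 iotaDl count_map. Qed.

Lemma common_junta (I : finType) (f : nat -> {ffun I -> bool} -> bool) (Z : seq nat) w :
  (forall q, q \in Z -> exists2 H : {set I}, #|H| <= w &
     forall x y : {ffun I -> bool}, {in H, x =1 y} -> f q x = f q y) ->
  exists2 H : {set I}, #|H| <= size Z * w & forall q, q \in Z ->
     forall x y : {ffun I -> bool}, {in H, x =1 y} -> f q x = f q y.
Proof.
elim: Z => [|q Z IH] juntaZ; first by exists set0; rewrite ?cards0.
have [|H leH juntaH] := IH; first by move=> q' q'Z; apply: juntaZ; rewrite inE q'Z orbT.
have [|H' leH' juntaH'] := juntaZ q; first by rewrite mem_head.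
exists (H' :|: H).
  by rewrite (leq_trans (leq_card_setU _ _)) // mulSn leq_add.
move=> q'; rewrite inE => /predU1P[->|q'Z] x y xy.
  by apply: juntaH' => i iH; apply: xy; rewrite inE iH.
by apply: (juntaH q' q'Z) => i iH; apply: xy; rewrite inE iH orbT.
Qed.

(** If the depth were at most [d], then [l] rounds for the dense negations and one for the output
    would leave a board on which the circuit is constant but the clique function is not. *)
Theorem clique_circuit_depth (n l k w s d : nat) (C : circuit (edge n)) :
  computes C (CLIQUE s) -> negations C = l + k -> k <= sparse_negations C w ->
  8 * (k * w) <= n -> 0 < d -> ((4 * d) ^ 4) ^ l.+1 * s * 2 <= n ->
  (l.+1 * (4 * d) ^ 4).+1 < s -> d < depth C.
Proof.
move=> compC negC le_k le_kw d0 le_n lt_s; rewrite ltnNge; apply/negP => le_d.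
pose N := size (gates C).
pose sparse i := if onth (gates C) i is Some (NotGate j) then
  orientation_weight (gate_fun C j) + orientation_weight (gate_fun C i) <= w else false.
pose Z := take k [seq i <- iota 0 N | sparse i].
have sizeZ : size Z = k by rewrite size_takel // size_filter.
have subZ : {subset Z <= [seq i <- iota 0 N | sparse i]} by move=> q /mem_take.
have sparseZ q : q \in Z -> sparse q by move/subZ; rewrite mem_filter => /andP[].
have [H leH juntaH] : exists2 H : {set edge n}, #|H| <= size Z * w & forall q, q \in Z ->
    forall x y : {ffun edge n -> bool}, {in H, x =1 y} -> gate_fun C q x = gate_fun C q y.
  apply: common_junta => q /sparseZ; rewrite /sparse.
  case gq : (onth (gates C) q) => [[//|j|//|//]|//] le_w.
  have [|H leH juntaH] := @negation_junta _ (gate_fun C j) (gate_fun C q).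
    by move=> x; rewrite (gate_funE x gq).
  by exists H => //; apply: leq_trans le_w.
(* The edges of [H] touch at most [2 * k * w <= n / 4] vertices, so more than half of the vertices
   would survive; half is all that is required. *)
pose W0 := ~: \bigcup_(e in H) (val e : {set 'I_n}).
have cardW0 : n <= #|W0| * 2.
  have : #|\bigcup_(e in H) (val e : {set 'I_n})| <= 2 * (k * w).
    apply: leq_trans (card_bigcup_le _ _) _.
    rewrite (eq_bigr (fun=> 2)) => [|e _]; last exact/eqP/(valP e).
    by rewrite sum_nat_const mulnC leq_mul2l -sizeZ leH.
  have := cardsC (\bigcup_(e in H) (val e : {set 'I_n})); rewrite card_ord -/W0.
  by move: #|_| #|_| (k * w) le_kw => a b t; clear; lia.
(* Every edge of [H] leaves [W0], so it is absent from all graphs on the initial board. *)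
have constZ q : q \in Z -> constant_in (in_board [ffun=> false] W0) (gate_fun C q).
  move=> qZ; exists (gate_fun C q [ffun=> false]) => x xW0; apply: juntaH => // e eH.
  apply: xW0; rewrite -disjoints_subset; apply/pred0Pn.
  have [u [v [_ ve]]] := edgeP e.
  have ue : u \in val e by rewrite ve !inE eqxx.
  by exists u; rewrite /= ue; apply/bigcupP; exists e.
(* The members of [Z] and the negations outside [Z] are disjoint lists of negation gates, of which
   there are [l + k] in all. *)
have le_dense : dense_nots C Z N <= l.
  rewrite -(leq_add2r k) -negC -sizeZ /dense_nots -size_filter -size_cat.
  rewrite /negations count_onth -size_filter; apply: uniq_leq_size.
    rewrite cat_uniq take_uniq ?filter_uniq ?iota_uniq //= andbT.
    apply/hasPn => q qZ; rewrite mem_filter negb_and; apply/orP; left.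
    by rewrite negb_and negbK qZ orbT.
  move=> q; rewrite mem_cat => /orP[|/subZ]; rewrite !mem_filter.
    by rewrite /is_not => /andP[/andP[+ _] ->]; case: (onth _ q) => [[]|].
  by case/andP=> + ->; rewrite /sparse; case: (onth _ q) => [[]|].
have [|||g [W [bd leW sub constW]]] := @exists_board_nots_constant n C d Z d0 W0 l.+1 s N constZ => //.
- by rewrite -(leq_pmul2r (ltn0Sn 1)) (leq_trans le_n).
- exact: leqW.
(* Of the [l.+1] budgeted rounds at most [l] are spent, so a factor [(4 * d) ^ 4] remains for the
   output gate. *)
have leW' : (4 * d) ^ 4 * s <= #|W|.
  apply: leq_trans leW; rewrite leq_mul2r -[X in X <= _]expn1; apply/orP; right.
  rewrite leq_pexp2l ?expn_gt0 ?muln_gt0 ?d0 // subn_gt0; exact: le_dense.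
have [|q j _ qd gq|g' [W' [bd' leW2 sub' [c constc]]]] :=
    gate_round d0 bd leW' (output_lt C).
- exact: le_d.
- by apply: (constW q j) => //; rewrite -onthTE gq.
have [|x [y [xW yW nx cy]]] := board_clique (board_weaken _ bd') leW2 lt_s.
  by rewrite -mulSnr leq_mul2r ltnS le_dense orbT.
by move: nx cy; rewrite -!compC !constc //; case: (c).
Qed.

(** * Choice of parameters *)

Section Numerics.
Local Open Scope ring_scope.
Variable R : realType.

Lemma powR_log2 (x : R) : 0 < x -> 2 `^ (log2 x) = x.
Proof.
move=> x0; rewrite /powR pnatr_eq0 /= /log2 divfK ?lnK //.
by rewrite gt_eqF // ln_gt0 // ltr1n.
Qed.

Lemma log2_ge (x y : R) : 2 `^ y <= x -> y <= log2 x.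
Proof.
have ln2 : 0 < ln (2 : R) by rewrite ln_gt0 // ltr1n.
move=> le_x; rewrite /log2 ler_pdivlMr // -ln_powR ler_ln //.
  by rewrite posrE powR_gt0.
by rewrite posrE (lt_le_trans _ le_x) // powR_gt0.
Qed.

(** The hypothesis says [2 ^ l] is at most the sixth root of [lam], so a quadratic in [2 ^ l] is
    dominated once [2 ^ l > 16]; for smaller values the bound [64 ^ 3] on [lam] suffices. *)
Lemma log2_large (l : nat) (lam : R) : 64 * 64 * 64 <= lam ->
  l%:R <= 1 / 6 * log2 lam ->
  128 * (2 ^+ l.+1) * (2 ^+ l.+1 + 20) <= lam.
Proof.
move=> lam_ge le_l; have lam0 : 0 < lam by lra.
have le_lam : (2 ^+ l) ^+ 6 <= lam.
  rewrite -exprM -powR_mulrn // -[leRHS]powR_log2 // ler_powR ?ler1n //.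
  by rewrite natrM; lra.
rewrite exprS; have a1 : 1 <= 2 ^+ l :> R by rewrite exprn_ege1 // ler1n.
move: (2 ^+ l) a1 le_lam => a a1 le_lam.
have [a16|a16] := leP a 16; first by nra.
apply: le_trans le_lam.
have a2 : 256 <= a ^+ 2 by rewrite expr2; nra.
have a4 : 256 * 256 <= a ^+ 4 by rewrite -[4%N]/(2 * 2)%N exprM expr2; nra.
rewrite -[6%N]/(2 + 4)%N exprD; apply: le_trans (_ : a ^+ 2 * (256 * 256) <= _); last first.
  by rewrite ler_wpM2l // exprn_ge0; lra.
by rewrite expr2; nra.
Qed.

(** Everything is measured by [u = n ^ (1 / (128 * alpha))] and [sigma = n ^ (1 / (6 * alpha))]:
    here [d <= u] because [2 ^ (l + 8) = 128 * (alpha + 1)], and [u ^ 21 <= sigma] because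
    [21 * 6 <= 128]. *)
Lemma clique_parameters (n l s d : nat) : 2 `^ (64 * 64 * 64) <= n%:R :> R ->
  l%:R <= 1 / 6 * log2 (log2 (n%:R : R)) ->
  `|s%:R - (n%:R : R) `^ (1 / (6 * (2 ^ l.+1 - 1)%N%:R))| < 1 ->
  (0 < d)%N -> d%:R <= (n%:R : R) `^ (1 / (2 ^+ (l + 8))) ->
  (((4 * d) ^ 4) ^ l.+1 * s * 2 <= n /\ (l.+1 * (4 * d) ^ 4).+1 < s)%N.
Proof.
move=> n_ge le_l near_s d0 le_d.
have N0 : 0 < n%:R :> R by apply: lt_le_trans n_ge; rewrite powR_gt0.
have lam_ge := log2_ge n_ge.
have := log2_large lam_ge le_l; set lam := log2 _ in lam_ge le_l *.
have NE : n%:R = 2 `^ lam :> R by rewrite powR_log2.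
set alpha := (2 ^ l.+1 - 1)%N in near_s *.
have le_lalpha : (l.+1 <= alpha)%N.
  by have := ltn_expl l.+1 (ltnSn 1); rewrite /alpha; lia.
have alphaE : 2 ^+ l.+1 = alpha%:R + 1 :> R.
  by rewrite -natrX natr1 /alpha; congr (_%:R); have := expn_gt0 2 l.+1; lia.
have al1 : 1 <= alpha%:R :> R by rewrite ler1n; lia.
rewrite alphaE => lam_big.
pose u : R := n%:R `^ (1 / (128 * alpha%:R)).
pose sigma : R := n%:R `^ (1 / (6 * alpha%:R)).
have N1 : 1 <= n%:R :> R.
  by rewrite NE -[leLHS](powRr0 2) ler_powR ?ler1n //; lra.
have le_du : d%:R <= u.
  apply: le_trans le_d _; rewrite ler_powR // -addSnnS exprD alphaE !mul1r.
  have -> : 2 ^+ 7 = 128 :> R by rewrite -natrX.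
  by rewrite lef_pV2 ?posrE; lra.
(* In exponents of 2 this asks for [(20 + alpha) * 128 * alpha <= lam], which is what [log2_large]
   provides. *)
have u_big : 2 ^+ 20 * alpha%:R <= u.
  rewrite /u NE -powRrM; apply: le_trans (_ : 2 `^ ((20 + alpha)%N%:R) <= _).
    rewrite powR_mulrn // exprD ler_wpM2l ?exprn_ge0 //.
    by rewrite -natrX ler_nat ltnW // ltn_expl.
  rewrite ler_powR ?ler1n // mul1r ler_pdivlMr; last by lra.
  by rewrite natrD; nra.
have le_us : u ^+ 21 <= sigma.
  rewrite -powR_mulrn ?powR_ge0 // -powRrM ler_powR //.
  rewrite [X in X * _]mul1r mulrC ler_pdivrMr; last by lra.
  by rewrite mulrAC mul1r ler_pdivlMr; lra.
have sigmaE : sigma ^+ (6 * alpha) = n%:R.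
  rewrite -powR_mulrn ?powR_ge0 // -powRrM natrM mul1r mulVf ?powRr1 // ?ltW //.
  by rewrite mulf_neq0 // gt_eqF //; lra.
have u1 : 2 ^+ 20 <= u by apply: le_trans u_big; rewrite ler_peMr ?exprn_ge0.
have u1k : 1024 <= u by apply: le_trans u1; rewrite -natrX ler_nat.
have alu : alpha%:R <= u.
  by apply: le_trans u_big; rewrite ler_peMl ?ler0n // exprn_ege1 // ler1n.
have s_gt : sigma - 1 < s%:R by move: near_s; rewrite -/sigma ltr_distl => /andP[].
have s_lt : s%:R < sigma + 1 by move: near_s; rewrite -/sigma ltr_distl => /andP[].
(* The number of colours is at most [256 * u ^ 5 + 1 <= u ^ 6 + 1]; the slack 3 also absorbs the
   rounding of [s]. *)
have u21 : u ^+ 6 + 3 <= u ^+ 21.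
  rewrite -[21%N]/(6 + 15)%N exprD.
  have u6 : 1 <= u ^+ 6 by rewrite exprn_ege1; lra.
  have u15 : 1024 <= u ^+ 15.
    by apply: (le_trans u1k); rewrite exprS ler_peMr ?exprn_ege1; lra.
  by nra.
have lt_s : (l.+1 * (4 * d) ^ 4).+1%:R < s%:R :> R.
  rewrite -natr1 natrM natrX natrM.
  have d4 : (4 * d%:R) ^+ 4 <= 256 * u ^+ 4 :> R.
    have -> : 256 * u ^+ 4 = (4 * u) ^+ 4 by rewrite exprMn -natrX.
    by rewrite lerXn2r ?nnegrE ?mulr_ge0 //; lra.
  have l_le : l.+1%:R <= u :> R by apply: le_trans alu; rewrite ler_nat.
  have : l.+1%:R * (4 * d%:R) ^+ 4 <= u * (256 * u ^+ 4) :> R.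
    by rewrite ler_pM // exprn_ge0 // mulr_ge0.
  have : u * (256 * u ^+ 4) <= u ^+ 6.
    rewrite [leLHS]mulrCA -exprS [u ^+ 6]exprS ler_wpM2r ?exprn_ge0; lra.
  by lra.
split; last by rewrite ltr_nat in lt_s.
have sigma2 : 2 <= sigma.
  have : 1 <= u ^+ 6 by rewrite exprn_ege1; lra.
  by lra.
have s_sq : s%:R <= sigma ^+ 2 by rewrite expr2; nra.
rewrite ltr_nat in lt_s.
have p_le : ((4 * d) ^ 4 <= s)%N.
  by apply: leq_trans (ltnW (ltnW lt_s)); rewrite leq_pmull.
have s0 : (0 < s)%N by apply: leq_trans lt_s.
(* From [(4 * d) ^ 4 <= s] and [s <= sigma ^ 2] the left side is at most [2 * s ^ (2 * alpha) <= 2 *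
   sigma ^ (4 * alpha)], and the factor 2 fits into the remaining [sigma ^ (2 * alpha)]. *)
apply: (@leq_trans (s ^ (2 * alpha) * 2)).
  rewrite leq_mul2r orFb; apply: (@leq_trans (s ^ l.+2)).
    by rewrite (expnSr s) leq_mul2r leq_exp2r ?p_le ?orbT.
  by rewrite leq_pexp2l // -addn1 mul2n -addnn leq_add // (leq_trans _ le_lalpha).
rewrite -(ler_nat R) -sigmaE natrM natrX.
rewrite (_ : (6 * alpha = 2 * (2 * alpha) + 2 * alpha)%N); last first.
  by rewrite mulnA -mulnDl.
rewrite exprD [sigma ^+ (2 * (2 * alpha))]exprM ler_pM ?exprn_ge0 //.
  by rewrite lerXn2r ?nnegrE ?exprn_ge0 // ltW // (lt_le_trans _ sigma2).
apply: le_trans (_ : sigma ^+ 1 <= _); first by rewrite expr1.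
rewrite ler_weXn2l ?(le_trans _ sigma2) ?ler1n //.
by rewrite muln_gt0 (leq_trans _ le_lalpha).
Qed.

End Numerics.

(** * The depth bound for large [n] *)

Unset Implicit Arguments.
Set Strict Implicit.

Local Open Scope ring_scope.

(** The clique size [n ^ (1 / (6 * alpha))] need not be an integer; the condition on [s] admits
    rounding it either way. *)
Theorem theorem3 (R : realType) :
  exists n0 : nat, forall (n l k w s alpha : nat) (C : circuit (edge n)),
    (n0 <= n)%N ->
    l%:R <= 1 / 6 * log2 (log2 (n%:R : R)) ->
    alpha = (2 ^ l.+1 - 1)%N ->
    `|s%:R - (n%:R : R) `^ (1 / (6 * alpha%:R))| < 1 ->
    computes C (CLIQUE s) ->
    negations C = (l + k)%N ->
    (k <= sparse_negations C w)%N ->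
    (k * w)%:R <= n%:R / 8 :> R ->
    (n%:R : R) `^ (1 / (2 ^+ (l + 8))) <= (depth C)%:R.
Proof.
(* This makes [log2 n] at least [64 ^ 3], the threshold of [log2_large]. *)
pose n0 := Num.bound (2 `^ (64 * 64 * 64) : R).
exists n0 => n l k w s _ C le_n le_l -> near_s compC negC le_k le_kw.
have n_ge : 2 `^ (64 * 64 * 64) <= n%:R :> R.
  apply: le_trans (ltW (archi_boundP _)) _; first exact: powR_ge0.
  by rewrite ler_nat.
rewrite leNgt; apply/negP => lt_d.
(* The rounds require [d > 0]; raising depth 0 to 1 is harmless, as the claimed bound is at least
   1. *)
pose d := maxn (depth C) 1.
have N1 : 1 <= n%:R :> R.
  by apply: le_trans n_ge; rewrite -[leLHS](powRr0 2) ler_powR ?ler1n //; lra.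
have le_d : d%:R <= (n%:R : R) `^ (1 / (2 ^+ (l + 8))).
  rewrite /d /maxn; case: ifP => _; last exact: ltW.
  by rewrite -[leLHS](powRr0 n%:R) ler_powR // divr_ge0 // exprn_ge0.
have d_gt0 : (0 < d)%N by rewrite leq_maxr.
have [le_s lt_s] := clique_parameters n_ge le_l near_s d_gt0 le_d.
have le_kw8 : (8 * (k * w) <= n)%N.
  by rewrite -(ler_nat R) natrM; move: le_kw; lra.
have := clique_circuit_depth compC negC le_k le_kw8 d_gt0 le_s lt_s.
by rewrite ltnNge leq_maxl.
Qed.
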